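(* Let $k\ge1$ and $n\ge2$ be integers, $\mathcal X=[n]=\{1,\dots,n\}$, $\mathcal Y=[n]^k$, $\pi=\mathrm{Unif}(\mathcal X)$, and let $K:\mathcal X\to\mathcal Y$ be the Markov kernel $$K(x,y)=\frac1{k\,n^{k-1}}\sum_{j=1}^k\mathbf 1\{y_j=x\}.$$ Let $P=KK_\pi^*$, where $K_\pi^*(y,x)=\frac1k\sum_{j=1}^k\mathbf 1\{y_j=x\}$ is the reverse kernel of $K$ with respect to $\pi$. Then, for fixed $k$ as $n\to\infty$, $\alpha(\pi,K)=O\left(\frac1{\log n}\right)$; and $\delta(\pi,P)\ge1-\frac1k$. In particular, for fixed $k\ge2$, $\frac{\delta(\pi,P)}{\alpha(\pi,K)}=\Omega(\log n)$ as $n\to\infty$.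
   Context: A Markov kernel $K:\mathcal X\to\mathcal Y$ between finite sets is a nonnegative matrix $(K(x,y))$ with rows summing to $1$; $(\nu K)(y)=\sum_x\nu(x)K(x,y)$. The reverse kernel is $K_\pi^*(y,x)=\frac{\pi(x)K(x,y)}{(\pi K)(y)}$ if $(\pi K)(y)>0$ and $K_\pi^*(y,x)=\pi(x)$ otherwise. $D(\nu\|\pi)=\sum_x\nu(x)\log\frac{\nu(x)}{\pi(x)}$ is the KL divergence (natural logarithm, $0\log 0=0$, $+\infty$ if $\nu\not\ll\pi$). Half-step entropy contraction coefficient: $\alpha(\pi,K)=1-\sup_{\nu:\,0<D(\nu\|\pi)<\infty}\frac{D(\nu K\|\pi K)}{D(\nu\|\pi)}$. Full-step entropy contraction coefficient: $\delta(\pi,P)=1-\sup_{\nu:\,0<D(\nu\|\pi)<\infty}\frac{D(\nu P\|\pi)}{D(\nu\|\pi)}$. In both, $\nu$ ranges over probability distributions on $\mathcal X$. The implied constants in $O,\Omega$ may depend on $k$ but not on $n$. *)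

(* Defs.v *)
From HB Require Import structures.
From mathcomp Require Export all_boot all_order all_algebra.
From mathcomp Require Export all_classical all_reals all_analysis.
Export Order.TTheory GRing.Theory Num.Theory.
Export numFieldNormedType.Exports.

Set Implicit Arguments.
Unset Strict Implicit.
Unset Printing Implicit Defensive.

Local Open Scope classical_set_scope.
Local Open Scope ring_scope.

Section FiniteKernels.
Variable R : realType.
Implicit Types X Y Z : finType.

Definition is_dist X (nu : X -> R) : Prop :=
  (forall x, 0 <= nu x) /\ \sum_x nu x = 1.

Definition is_markov_kernel X Y (K : X -> Y -> R) : Prop :=
  forall x, is_dist (K x).

Definition push X Y (nu : X -> R) (K : X -> Y -> R) : Y -> R :=
  fun y => \sum_x nu x * K x y.

Definition kcomp X Y Z (K : X -> Y -> R) (L : Y -> Z -> R) : X -> Z -> R :=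
  fun x z => \sum_y K x y * L y z.

Definition reverse_kernel X Y (pi : X -> R) (K : X -> Y -> R) : Y -> X -> R :=
  fun y x => if 0 < push pi K y then pi x * K x y / push pi K y else pi x.

Definition abs_cont X (nu pi : X -> R) : bool :=
  [forall x, (pi x == 0) ==> (nu x == 0)].

(* [ln] is total with [ln x = 0] for [x <= 0], so a term with [nu x = 0]
   vanishes, in accordance with 0 log 0 = 0. *)
Definition kl X (nu pi : X -> R) : \bar R :=
  if abs_cont nu pi then (\sum_x nu x * ln (nu x / pi x))%:E else +oo%E.

Definition admissible X (pi : X -> R) : set (X -> R) :=
  [set nu | is_dist nu /\ (0 < kl nu pi < +oo)%E].

(* Both coefficients are taken in the extended reals so that the supremum is
   the genuine one, whether or not the set of ratios is empty or bounded. *)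
Definition half_step_coef X Y (pi : X -> R) (K : X -> Y -> R) : \bar R :=
  (1 - ereal_sup
         [set kl (push nu K) (push pi K) / kl nu pi | nu in admissible pi])%E.

Definition full_step_coef X (pi : X -> R) (P : X -> X -> R) : \bar R :=
  (1 - ereal_sup
         [set kl (push nu P) pi / kl nu pi | nu in admissible pi])%E.

Definition unif X : X -> R := fun=> #|X|%:R^-1.

End FiniteKernels.

Arguments unif R X : clear implicits.

Section Example.
Variables (R : realType) (k n : nat).

Definition coordK (x : 'I_n) (y : {ffun 'I_k -> 'I_n}) : R :=
  (k%:R * n%:R ^+ k.-1)^-1 * \sum_(j < k) (y j == x)%:R.

Definition coordP : 'I_n -> 'I_n -> R :=
  kcomp coordK (reverse_kernel (unif R 'I_n) coordK).

Definition alpha_coord : \bar R := half_step_coef (unif R 'I_n) coordK.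

Definition delta_coord : \bar R := full_step_coef (unif R 'I_n) coordP.

End Example.

(* Main.v *)
Require Import Defs.
From HB Require Import structures.
From mathcomp Require Import all_boot all_order all_algebra.
From mathcomp Require Import all_classical all_reals all_analysis.
From mathcomp Require Import ring lra.

Set Implicit Arguments.
Unset Strict Implicit.
Unset Printing Implicit Defensive.

Local Open Scope classical_set_scope.
Local Open Scope ring_scope.

(** With [f = n nu] and [phi t = t ln t], the divergence from the uniform
    distribution is the mean of [phi (f x)], and [K] replaces [f] by the average
    of [f] over [k] independent uniform coordinates.

    A Dirac mass has divergence [ln n], and every positive entry of [K] is at least
    [n / k] times the uniform weight, so its image has divergence at least
    [ln n - ln k]; hence [alpha <= ln k / ln n].  On the other hand
    [P = k^-1 I + (1 - k^-1) U] with [U] the resampling kernel, so convexity of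
    [phi] gives [delta >= 1 - k^-1].

    The quotient [delta / alpha] is only meaningful once [alpha > 0]. Since [phi]
    is strongly convex on [[0, n]], averaging decreases the mean of [phi (f x)]
    by a multiple of the variance of [f], which dominates the divergence; this
    gives [alpha >= (1 - k^-1) / (4 n)]. *)

(** * Moments of sums over independent coordinates *)

Lemma sumr_const_mul (R : pzRingType) (I : finType) (c : R) :
  \sum_(i : I) c = #|I|%:R * c.
Proof. by rewrite sumr_const mulr_natl. Qed.

Section SumsOverProducts.
Variables (R : comNzRingType) (I T : finType).

(** A product of sums distributes into a sum over functions; with factor [g] at [j] and 1 elsewhere,
    each other index contributes [#|T|]. *)
Lemma sum_ffun_coord (g : T -> R) (j : I) :
  \sum_(y : {ffun I -> T}) g (y j) = #|T|%:R ^+ #|I|.-1 * \sum_x g x.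
Proof.
pose F i x := if i == j then g x else 1.
have E : \prod_i \sum_x F i x = \sum_(y : {ffun I -> T}) \prod_i F i (y i).
  by rewrite bigA_distr_bigA.
rewrite (bigD1 j) //= /F eqxx in E.
rewrite (_ : \prod_(i | i != j) _ = #|T|%:R ^+ #|I|.-1) in E; last first.
  rewrite (eq_bigr (fun=> #|T|%:R)); last first.
    by move=> i /negPf ->; rewrite sumr_const.
  by rewrite prodr_const cardC1.
rewrite mulrC E; apply: eq_bigr => y _.
rewrite (bigD1 j) //= eqxx big1 ?mulr1 //.
by move=> i /negPf ->.
Qed.

Lemma sum_ffun_coord2 (g h : T -> R) (i j : I) : i != j ->
  \sum_(y : {ffun I -> T}) g (y i) * h (y j)
    = #|T|%:R ^+ #|I|.-2 * ((\sum_x g x) * \sum_x h x).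
Proof.
move=> ij; have ji : j != i by rewrite eq_sym.
pose F l x := if l == i then g x else if l == j then h x else 1.
have E : \prod_i \sum_x F i x = \sum_(y : {ffun I -> T}) \prod_i F i (y i).
  by rewrite bigA_distr_bigA.
rewrite (bigD1 i) //= (bigD1 j) //= /F !eqxx (negPf ji) in E.
rewrite (_ : \prod_(l | _) _ = #|T|%:R ^+ #|I|.-2) in E; last first.
  rewrite (eq_bigr (fun=> #|T|%:R)); last first.
    by move=> l /andP[/negPf -> /negPf ->]; rewrite sumr_const.
  rewrite prodr_const -(cardC1 i) (cardD1 j (predC1 i)) inE ji add1n /=.
  by congr (_ ^+ _); apply: eq_card => l; rewrite !inE andbC.
rewrite mulrC -mulrA E; apply: eq_bigr => y _.
rewrite (bigD1 i) //= (bigD1 j) //= !eqxx (negPf ji) big1 ?mulr1 //.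
by move=> l /andP[/negPf -> /negPf ->].
Qed.

End SumsOverProducts.

(** Diagonal pairs [i = j] give the sum of [g x * h x]; off the diagonal the coordinates are
    independent and the sums factor. *)
Lemma sum_ffun_prod_sums (R : numFieldType) (I T : finType) (g h : T -> R) :
  (0 < #|I|)%N -> (0 < #|T|)%N ->
  \sum_(y : {ffun I -> T}) (\sum_i g (y i)) * (\sum_j h (y j))
    = #|I|%:R * #|T|%:R ^+ #|I|.-1 *
      (\sum_x g x * h x
       + (#|I|%:R - 1) / #|T|%:R * ((\sum_x g x) * \sum_x h x)).
Proof.
move=> I0 T0; have T0R : #|T|%:R != 0 :> R by rewrite pnatr_eq0 -lt0n.
under eq_bigr do rewrite big_distrlr; rewrite exchange_big /=.
under eq_bigr => i _.
  rewrite exchange_big /= (bigD1 i) //=.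
  rewrite (sum_ffun_coord (fun x => g x * h x)).
  under eq_bigr => j ji do rewrite sum_ffun_coord2 1?eq_sym //.
  rewrite sumr_const cardC1.
  over.
rewrite sumr_const_mul -mulrA; congr (_ * _).
rewrite mulrDr; congr (_ + _).
have -> : #|I|%:R - 1 = #|I|.-1%:R :> R by rewrite -subn1 natrB.
(* With a single index the exponent [#|I|.-2] is truncated to 0, but there are no off-diagonal
   pairs. *)
case: (#|I|.-1) => [|m]; first by rewrite mulr0n !mul0r mulr0.
by rewrite exprS -mulr_natl; field.
Qed.

(** * Convexity of [t ln t] *)

Section Xlnx.
Variable R : realType.
Implicit Types b m t N : R.

Definition xlnx t : R := t * ln t.

(** The tangent of [xlnx] at [m], of slope [ln m + 1], lies below the graph. For [b > 0] this is
    [ln u <= u - 1] at [u = m / b], multiplied by [b]. *)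
Lemma xlnx_tangent b m : 0 <= b -> 0 < m -> b - m <= xlnx b - b * ln m.
Proof.
move=> b0 m0; move: b0; rewrite le_eqVlt => /orP[/eqP <-|b0].
  by rewrite /xlnx !mul0r; lra.
have : ln (m / b) <= m / b - 1.
  have mb : 0 < m / b by rewrite divr_gt0.
  by rewrite -{1}(subrK 1 (m / b)) addrC le_ln1Dx //; lra.
rewrite ln_div ?posrE // -(ler_pM2l b0) /xlnx !mulrBr (mulrC m) mulVKf ?gt_eqF //.
by lra.
Qed.

(* Applying [ln x <= x - 1] to the square root of [m / b] gains the quadratic
   term [(sqrt b - sqrt m)^2], which dominates [(b - m)^2 / (4 N)]. *)
Lemma xlnx_strong_tangent b m N : 0 <= b <= N -> 0 < m <= N ->
  b - m + (4 * N)^-1 * (b - m) ^+ 2 <= xlnx b - b * ln m.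
Proof.
move=> /andP[b0 bN] /andP[m0 mN].
have N0 : 0 < N by apply: lt_le_trans mN.
have N40 : 0 < 4 * N by lra.
move: b0; rewrite le_eqVlt => /orP[/eqP <-|b0].
  rewrite /xlnx !mul0r !sub0r sqrrN oppr0 addrC subr_le0.
  by rewrite ler_pdivrMl // expr2 ler_pM2r //; lra.
pose s : R := Num.sqrt b; pose t : R := Num.sqrt m.
have s0 : 0 < s by rewrite sqrtr_gt0.
have t0 : 0 < t by rewrite sqrtr_gt0.
have bE : b = s ^+ 2 by rewrite sqr_sqrtr // ltW.
have mE : m = t ^+ 2 by rewrite sqr_sqrtr // ltW.
have ts : 0 < t / s by rewrite divr_gt0.
have h1 : 2 * s * (s - t) <= xlnx b - b * ln m.
  have : ln (t / s) <= t / s - 1.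
    by rewrite -{1}(subrK 1 (t / s)) addrC le_ln1Dx //; lra.
  have s20 : 0 < 2 * s ^+ 2 by rewrite mulr_gt0 ?exprn_gt0.
  rewrite ln_div ?posrE // => /(ler_wpM2l (ltW s20)).
  rewrite /xlnx bE mE !lnXn //.
  rewrite (_ : 2 * s ^+ 2 * (t / s - 1) = 2 * s * (t - s)); last first.
    by field; rewrite gt_eqF.
  by rewrite !mulr2n; lra.
apply: le_trans h1.
(* The constant 4 comes from [(s + t) ^+ 2 <= 2 * (b + m) <= 4 * N]. *)
have : (4 * N)^-1 * (b - m) ^+ 2 <= (s - t) ^+ 2.
  rewrite ler_pdivrMl // {1}bE {1}mE subr_sqr exprMn mulrC ler_wpM2r ?sqr_ge0 //.
  have := sqr_ge0 (s - t).
  have : (s + t) ^+ 2 + (s - t) ^+ 2 = 2 * (b + m) by rewrite bE mE; ring.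
  by lra.
by rewrite bE mE; lra.
Qed.

(** Jensen's inequality with a variance gain: summing the strong tangent inequality at the mean [M]
    cancels the linear terms and leaves the variance. *)
Lemma xlnx_mean_le (I : finType) (b : I -> R) N M : (0 < #|I|)%N ->
  (forall i, 0 <= b i <= N) -> M = #|I|%:R^-1 * \sum_i b i ->
  xlnx M + (4 * N)^-1 * (#|I|%:R^-1 * \sum_i (b i) ^+ 2 - M ^+ 2)
    <= #|I|%:R^-1 * \sum_i xlnx (b i).
Proof.
move=> I0 bN ME; have I0R : 0 < #|I|%:R :> R by rewrite ltr0n.
have Sb : \sum_i b i = #|I|%:R * M by rewrite ME mulVKf ?gt_eqF.
have M0 : 0 <= M.
  by rewrite ME mulr_ge0 ?invr_ge0 ?ler0n ?sumr_ge0 // => i _; case/andP: (bN i).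
have MN : M <= N.
  rewrite ME ler_pdivrMl // mulr_natl -sumr_const.
  by apply: ler_sum => i _; case/andP: (bN i).
(* The tangent point must be positive; a zero mean forces every [b i] to vanish. *)
move: M0; rewrite le_eqVlt => /orP[/eqP M0|M0].
  have b0 i : b i = 0.
    move: Sb; rewrite -M0 mulr0 => /eqP; rewrite psumr_eq0; last first.
      by move=> j _; case/andP: (bN j).
    by move/allP => /(_ i); rewrite mem_index_enum => /(_ isT)/eqP.
  rewrite -M0 /xlnx !big1 ?mulr0 ?mul0r ?expr0n ?subr0 ?mulr0 ?addr0 //.
    by move=> i _; rewrite b0 mul0r.
  by move=> i _; rewrite b0 expr0n.
have : \sum_i (b i - M + (4 * N)^-1 * (b i - M) ^+ 2)
       <= \sum_i (xlnx (b i) - b i * ln M).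
  by apply: ler_sum => i _; apply: xlnx_strong_tangent => //; rewrite M0.
rewrite big_split /= -mulr_sumr !sumrB -mulr_suml sumr_const_mul Sb subrr add0r.
have -> : \sum_i (b i - M) ^+ 2 = \sum_i b i ^+ 2 - #|I|%:R * M ^+ 2.
  transitivity (\sum_i (b i ^+ 2 - 2 * M * b i + M ^+ 2)).
    by apply: eq_bigr => i _; ring.
  by rewrite big_split /= sumrB -mulr_sumr Sb sumr_const_mul; ring.
move=> h; rewrite -(ler_pM2l I0R) mulVKf ?gt_eqF //.
suff -> : #|I|%:R * (xlnx M + (4 * N)^-1 * (#|I|%:R^-1 * \sum_i b i ^+ 2 - M ^+ 2))
  = (4 * N)^-1 * (\sum_i b i ^+ 2 - #|I|%:R * M ^+ 2) + #|I|%:R * M * ln M.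
  by rewrite -lerBrDr.
by rewrite /xlnx mulrDr (mulrCA _ (4 * N)^-1) mulrBr mulVKf ?gt_eqF // addrC mulrA.
Qed.

End Xlnx.

(** * Divergence from the uniform distribution *)

Section UniformKL.
Variables (R : realType) (X : finType).
Hypothesis X_gt0 : (0 < #|X|)%N.
Implicit Types nu : X -> R.

Let N0 : 0 < #|X|%:R :> R. Proof. by rewrite ltr0n. Qed.

Lemma kl_unif nu :
  kl nu (unif R X) = (#|X|%:R^-1 * \sum_x xlnx (#|X|%:R * nu x))%:E.
Proof.
rewrite /kl ifT; last first.
  by apply/forallP => x; rewrite /unif invr_eq0 gt_eqF.
congr (_%:E); rewrite mulr_sumr; apply: eq_bigr => x _.
by rewrite /xlnx /unif invrK [nu x * #|X|%:R]mulrC -mulrA mulKf ?gt_eqF.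
Qed.

Lemma sum_card_dist nu : is_dist nu -> \sum_x (#|X|%:R * nu x - 1) = 0.
Proof.
by move=> [_ nu1]; rewrite sumrB -mulr_sumr nu1 mulr1 sumr_const subrr.
Qed.

Lemma kl_unif_ge0 nu : is_dist nu -> (0 <= kl nu (unif R X))%E.
Proof.
move=> dnu; rewrite kl_unif lee_fin mulr_ge0 ?invr_ge0 ?ler0n //.
apply: le_trans (_ : \sum_x (#|X|%:R * nu x - 1) <= _).
  by rewrite sum_card_dist.
apply: ler_sum => x _.
have := @xlnx_tangent R (#|X|%:R * nu x) 1.
rewrite ln1 mulr0 subr0; apply => //.
by rewrite mulr_ge0 ?ler0n // dnu.1.
Qed.

(** The bound is the chi-squared divergence, that is, the variance of the density; pointwise,
    [xlnx t <= t * (t - 1)]. *)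
Lemma kl_unif_le_chi2 nu : is_dist nu ->
  #|X|%:R^-1 * \sum_x xlnx (#|X|%:R * nu x)
    <= #|X|%:R^-1 * \sum_x (#|X|%:R * nu x) ^+ 2 - 1.
Proof.
move=> dnu; rewrite -(ler_pM2l N0) mulrBr !mulVKf ?gt_eqF // mulr1.
rewrite (_ : _ - _ = \sum_x ((#|X|%:R * nu x) ^+ 2 - #|X|%:R * nu x)); last first.
  by rewrite sumrB -[in X in _ = _ - X]mulr_sumr dnu.2 mulr1.
apply: ler_sum => x _; set t := _ * nu x.
have : 0 <= t by rewrite mulr_ge0 ?ler0n // dnu.1.
rewrite le_eqVlt => /orP[/eqP <-|t0]; first by rewrite /xlnx mul0r expr0n subr0.
rewrite /xlnx expr2 -[X in _ - X]mulr1 -mulrBr ler_pM2l //.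
by rewrite -[X in ln X](subrK 1 t) addrC le_ln1Dx //; lra.
Qed.

End UniformKL.

Lemma push_dist (R : realType) (X Y : finType) (nu : X -> R) (K : X -> Y -> R) :
  is_dist nu -> is_markov_kernel K -> is_dist (push nu K).
Proof.
move=> [nu0 nu1] mK; split=> [y|].
  by apply: sumr_ge0 => x _; rewrite mulr_ge0 // (mK x).1.
rewrite exchange_big /= -nu1; apply: eq_bigr => x _.
by rewrite -mulr_sumr (mK x).2 mulr1.
Qed.

(** * From divergence inequalities to contraction coefficients *)

Section ContractionBounds.
Variables (R : realType) (X : finType) (pi : X -> R) (F : (X -> R) -> \bar R).

Let coef : \bar R :=
  (1 - ereal_sup [set F nu / kl nu pi | nu in admissible pi])%E.

(** Admissibility makes [kl nu pi] positive and finite, so one may divide by it; an empty supremum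
    is [-oo] and makes the coefficient [+oo]. *)
Lemma contraction_coef_ge (c : R) :
  (forall nu, admissible pi nu -> (F nu <= (1 - c)%:E * kl nu pi)%E) ->
  (c%:E <= coef)%E.
Proof.
move=> H; rewrite /coef.
suff : (ereal_sup [set F nu / kl nu pi | nu in admissible pi]
        <= (1 - c)%:E)%E.
  by case: ereal_sup => [r| |] //=; rewrite ?lee_fin ?leey // => h; lra.
apply: ge_ereal_sup => _ [nu anu <-].
have := H _ anu; case: anu => _ /andP[].
case: (kl nu pi) => [r| |] //=; rewrite lte_fin => r0 _ h.
by rewrite inver gt_eqF // lee_pdivrMr.
Qed.

Lemma contraction_coef_le (d : R) (nu : X -> R) : admissible pi nu ->
  ((1 - d)%:E * kl nu pi <= F nu)%E -> (coef <= d%:E)%E.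
Proof.
move=> anu H; rewrite /coef.
suff : ((1 - d)%:E
        <= ereal_sup [set F nu / kl nu pi | nu in admissible pi])%E.
  by case: ereal_sup => [r| |] //=; rewrite ?lee_fin ?leNye // => h; lra.
apply: le_trans (ereal_sup_ubound _); last by exists nu; [exact: anu|].
move: H; case: anu => _ /andP[].
case: (kl nu pi) => [r| |] //=; rewrite lte_fin => r0 _ h.
by rewrite inver gt_eqF // lee_pdivlMr.
Qed.

End ContractionBounds.

Lemma fin_num_between (R : realDomainType) (a b : R) (x : \bar R) :
  (a%:E <= x)%E -> (x <= b%:E)%E -> x \is a fin_num.
Proof. by case: x. Qed.

(** * Closed forms of [coordK], its reverse kernel and [coordP] *)

Section CoordKernel.
Variables (R : realType) (k n : nat).
Hypotheses (hk : (1 <= k)%N) (hn : (2 <= n)%N).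

Local Notation Y := {ffun 'I_k -> 'I_n}.
Local Notation K := (@coordK R k n).
Local Notation U := (unif R 'I_n).

Let k0 : 0 < k%:R :> R. Proof. by rewrite ltr0n. Qed.
Let n0 : 0 < n%:R :> R. Proof. by rewrite ltr0n ltnW. Qed.
Let cX : (0 < #|'I_n|)%N. Proof. by rewrite card_ord ltnW. Qed.
Let cardY : #|{: Y}| = (n ^ k)%N. Proof. by rewrite card_ffun !card_ord. Qed.
Let cY : (0 < #|{: Y}|)%N. Proof. by rewrite cardY expn_gt0 ltnW. Qed.
Let nk : n%:R ^+ k = n%:R * n%:R ^+ k.-1 :> R. Proof. by rewrite -exprS prednK. Qed.
Let nk1 : 0 < n%:R ^+ k.-1 :> R. Proof. exact: exprn_gt0. Qed.

Lemma coordK_markov : is_markov_kernel K.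
Proof.
move=> x; split=> [y|].
  apply: mulr_ge0; first by rewrite invr_ge0 ltW // mulr_gt0.
  by apply: sumr_ge0 => j _; rewrite ler0n.
rewrite -mulr_sumr exchange_big /=.
rewrite (eq_bigr (fun=> n%:R ^+ k.-1)); last first.
  move=> j _; rewrite (sum_ffun_coord (fun z => (z == x)%:R)) !card_ord.
  rewrite (bigD1 x) //= eqxx big1 ?addr0 ?mulr1 //.
  by move=> i /negPf ->.
by rewrite sumr_const_mul card_ord mulVf // gt_eqF // mulr_gt0.
Qed.

Lemma card_push_coordK (nu : 'I_n -> R) (y : Y) :
  #|{: Y}|%:R * push nu K y = k%:R^-1 * \sum_(j < k) (n%:R * nu (y j)).
Proof.
rewrite cardY natrX nk /push /coordK -mulr_sumr.
rewrite (_ : \sum_x _ = (k%:R * n%:R ^+ k.-1)^-1 * \sum_(j < k) nu (y j)); last first.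
  under eq_bigr do rewrite mulrCA; rewrite -mulr_sumr; congr (_ * _).
  under eq_bigr do rewrite mulr_sumr; rewrite exchange_big /=.
  apply: eq_bigr => j _; rewrite (bigD1 (y j)) //= eqxx mulr1 big1 ?addr0 // => x.
  by rewrite eq_sym => /negPf ->; rewrite mulr0.
by field; rewrite !gt_eqF.
Qed.

Lemma push_unif_coordK : push U K = unif R {: Y}.
Proof.
apply/funext => y; have Y0 : 0 < #|{: Y}|%:R :> R by rewrite ltr0n.
apply: (mulfI (lt0r_neq0 Y0)); rewrite card_push_coordK /unif card_ord.
by rewrite !mulfV ?gt_eqF // sumr_const_mul card_ord mulr1 mulVf ?gt_eqF.
Qed.

(** The image of the uniform law is uniform, hence positive everywhere, so only the Bayes branch of
    [reverse_kernel] occurs. *)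
Lemma reverse_coordK (y : Y) (x : 'I_n) :
  reverse_kernel U K y x = k%:R^-1 * \sum_(j < k) (y j == x)%:R.
Proof.
rewrite /reverse_kernel push_unif_coordK /unif invr_gt0 ltr0n cY.
rewrite invrK cardY natrX nk card_ord /coordK.
by field; rewrite !gt_eqF.
Qed.

(** A step of [coordP] writes [x] at a random coordinate and reads a random one: they coincide with
    probability [1 / k], and otherwise the letter read is uniform. *)
Lemma coordP_mixture (x z : 'I_n) :
  coordP R k x z = k%:R^-1 * (x == z)%:R + (1 - k%:R^-1) * n%:R^-1.
Proof.
rewrite /coordP /Defs.kcomp.
under eq_bigr do rewrite reverse_coordK /coordK mulrACA.
rewrite -mulr_sumr.
rewrite (sum_ffun_prod_sums (fun w => (w == x)%:R) (fun w => (w == z)%:R));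
  rewrite !card_ord //; last exact: ltnW.
have S1 (u : 'I_n) : \sum_w (w == u)%:R = 1 :> R.
  by rewrite (bigD1 u) //= eqxx big1 ?addr0 // => w /negPf ->.
rewrite !S1 (bigD1 x) //= eqxx mul1r big1 ?addr0; last first.
  by move=> w /negPf ->; rewrite mul0r.
by field; rewrite !gt_eqF.
Qed.

Lemma coordP_markov : is_markov_kernel (coordP R k (n := n)).
Proof.
move=> x; split=> [z|].
  rewrite coordP_mixture addr_ge0 ?mulr_ge0 ?invr_ge0 ?ler0n //.
  by rewrite subr_ge0 invf_le1 // ler1n.
under eq_bigr do rewrite coordP_mixture.
rewrite big_split /= -mulr_sumr sumr_const_mul card_ord (bigD1 x) //=.
rewrite eqxx big1 ?addr0; last by move=> z; rewrite eq_sym => /negPf ->.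
by rewrite mulr1; field; rewrite !gt_eqF.
Qed.

(** * Entropy contraction under [coordP] *)

Lemma card_push_coordP (nu : 'I_n -> R) (z : 'I_n) : is_dist nu ->
  n%:R * push nu (coordP R k (n := n)) z
    = k%:R^-1 * (n%:R * nu z) + (1 - k%:R^-1).
Proof.
move=> dnu; rewrite /push; under eq_bigr do rewrite coordP_mixture mulrDr.
rewrite big_split /= -mulr_suml dnu.2 mul1r (bigD1 z) //= eqxx big1 ?addr0.
  by rewrite mulr1; field; rewrite !gt_eqF.
by move=> x /negPf ->; rewrite !mulr0.
Qed.

Lemma kl_push_coordP_le (nu : 'I_n -> R) : is_dist nu ->
  (kl (push nu (coordP R k (n := n))) U <= k%:R^-1%:E * kl nu U)%E.
Proof.
move=> dnu; rewrite !kl_unif // -EFinM lee_fin card_ord mulrCA.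
rewrite ler_wpM2l ?invr_ge0 ?ler0n // [leRHS]mulr_sumr; apply: ler_sum => z _.
rewrite card_push_coordP //; set t := _ * nu z.
have t0 : 0 <= t by rewrite mulr_ge0 ?ler0n // dnu.1.
have kV0 : 0 < k%:R^-1 :> R by rewrite invr_gt0.
have kV1 : k%:R^-1 <= 1 :> R by rewrite invf_le1 // ler1n.
move: kV0 kV1; set c := k%:R^-1 => c0 c1; set m := _ + _.
(* For [k = 1] the point [m = t] may be 0, where no tangent is available. *)
have := c1; rewrite le_eqVlt => /orP[/eqP cE|c1'].
  by rewrite /m cE subrr addr0 !mul1r.
have ct0 : 0 <= c * t by rewrite mulr_ge0 // ltW.
have m0 : 0 < m by rewrite /m; lra.
(* The tangent at [m] is evaluated at [t] and at 1 with weights [c] and [1 - c]; the linear terms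
   cancel since [m] is the weighted mean, and [xlnx 1 = 0]. *)
have A := ler_wpM2l (ltW c0) (xlnx_tangent t0 m0).
have c2 : 0 <= 1 - c by rewrite subr_ge0.
have B := ler_wpM2l c2 (xlnx_tangent ler01 m0).
have xE : xlnx m = (c * t + (1 - c)) * ln m by [].
have mE : m = c * t + (1 - c) by [].
have x1 : xlnx (1 : R) = 0 by rewrite /xlnx ln1 mulr0.
rewrite x1 in B; rewrite xE.
have D : c * (t - m) + (1 - c) * (1 - m) = 0 by rewrite mE; ring.
by move: (lerD A B); rewrite D !mulrBr; lra.
Qed.

(** * Entropy contraction under [coordK] *)

Lemma mean_coord (g : 'I_n -> R) :
  #|{: Y}|%:R^-1 * \sum_(y : Y) (k%:R^-1 * \sum_(j < k) g (y j))
    = n%:R^-1 * \sum_x g x.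
Proof.
rewrite -mulr_sumr exchange_big /=.
under eq_bigr do rewrite sum_ffun_coord !card_ord.
rewrite sumr_const_mul card_ord cardY natrX nk.
by field; rewrite !gt_eqF.
Qed.

(** Distinct coordinates are independent, so averaging divides the variance by [k]. *)
Lemma mean_sqr_coord (g : 'I_n -> R) :
  #|{: Y}|%:R^-1 * \sum_(y : Y) (k%:R^-1 * \sum_(j < k) g (y j)) ^+ 2
    = k%:R^-1 * (n%:R^-1 * \sum_x g x ^+ 2)
      + (1 - k%:R^-1) * (n%:R^-1 * \sum_x g x) ^+ 2.
Proof.
have E := @sum_ffun_prod_sums R 'I_k 'I_n g g.
rewrite !card_ord in E; have {}E := E hk (ltnW hn).
under eq_bigr do rewrite exprMn [X in _ * X]expr2.
rewrite -mulr_sumr E cardY natrX nk.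
rewrite [X in _ = _ * (_ * X) + _](eq_bigr (fun x => g x * g x)) //.
by field; rewrite !gt_eqF.
Qed.

(** The variance [Q y - M y ^+ 2] among the coordinates of [y] has mean [(1 - 1 / k) * (V - 1)];
    strong convexity gains [1 / (4 * n)] times this, and [V - 1] dominates the divergence [D]. *)
Lemma kl_push_coordK_le (nu : 'I_n -> R) : is_dist nu ->
  (kl (push nu K) (push U K)
    <= (1 - (1 - k%:R^-1) / (4 * n%:R))%:E * kl nu U)%E.
Proof.
move=> dnu; rewrite push_unif_coordK !kl_unif // -EFinM lee_fin.
under eq_bigr do rewrite card_push_coordK.
have := kl_unif_le_chi2 cX dnu; rewrite card_ord.
set f := fun x => n%:R * nu x.
rewrite -/(\sum_x xlnx (f x)) -/(\sum_x (f x) ^+ 2).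
set D := n%:R^-1 * _; set V := n%:R^-1 * _ => DV.
(* Total mass 1 bounds the density by [n], the range used for strong convexity. *)
have fn x : 0 <= f x <= n%:R.
  rewrite mulr_ge0 ?dnu.1 ?ler0n //= -[leRHS]mulr1 ler_pM2l // -dnu.2.
  by rewrite (bigD1 x) //= lerDl sumr_ge0 // => z _; exact: dnu.1.
pose M (y : Y) := k%:R^-1 * \sum_(j < k) f (y j).
pose Q (y : Y) := k%:R^-1 * \sum_(j < k) f (y j) ^+ 2.
have H (y : Y) : xlnx (M y) + (4 * n%:R)^-1 * (Q y - M y ^+ 2)
    <= k%:R^-1 * \sum_(j < k) xlnx (f (y j)).
  have := @xlnx_mean_le R 'I_k (fun j => f (y j)) n%:R (M y).
  by rewrite card_ord; apply.
have Y0 : 0 < #|{: Y}|%:R :> R by rewrite ltr0n.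
have f1 : \sum_x f x = n%:R by rewrite -mulr_sumr dnu.2 mulr1.
have mean2 : #|{: Y}|%:R^-1 * \sum_y M y ^+ 2 = k%:R^-1 * V + (1 - k%:R^-1).
  by rewrite mean_sqr_coord f1 mulVf ?gt_eqF // expr1n mulr1.
have := ler_sum (index_enum Y) (fun y (_ : xpredT y) => H y).
have YV0 : 0 <= #|{: Y}|%:R^-1 :> R by rewrite invr_ge0 ler0n.
move=> /(ler_wpM2l YV0).
rewrite (mean_coord (fun x => xlnx (f x))) big_split /= -mulr_sumr sumrB.
have meanQ : #|{: Y}|%:R^-1 * \sum_y Q y = V by exact: mean_coord (fun x => f x ^+ 2).
rewrite mulrDr mulrCA mulrBr meanQ mean2 => G.
have c0 : 0 <= (1 - k%:R^-1) / (4 * n%:R) :> R.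
  by rewrite divr_ge0 ?mulr_ge0 ?ler0n // subr_ge0 invf_le1 // ler1n.
have := ler_wpM2l c0 DV.
move: G; set A := #|_|%:R^-1 * _ => G G2.
rewrite mulrBl mul1r.
have E : (4 * n%:R)^-1 * (V - (k%:R^-1 * V + (1 - k%:R^-1)))
  = (1 - k%:R^-1) / (4 * n%:R) * (V - 1) by ring.
by rewrite E in G; rewrite lerBrDr; apply: le_trans G; rewrite lerD2l.
Qed.

(** * Dirac masses and their images *)

Lemma dirac_dist (x0 : 'I_n) : is_dist (fun x => (x == x0)%:R : R).
Proof.
split=> [x|]; first by rewrite ler0n.
by rewrite (bigD1 x0) //= eqxx big1 ?addr0 // => w /negPf ->.
Qed.

Lemma kl_dirac (x0 : 'I_n) :
  kl (fun x => (x == x0)%:R : R) U = (ln n%:R)%:E.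
Proof.
rewrite kl_unif // card_ord (bigD1 x0) //= eqxx big1 ?addr0; last first.
  by move=> w /negPf ->; rewrite mulr0 /xlnx mul0r.
by rewrite /xlnx mulr1 mulKf ?gt_eqF.
Qed.

Let lnn0 : 0 < ln (n%:R : R). Proof. by rewrite ln_gt0 // ltr1n. Qed.

Lemma dirac_admissible (x0 : 'I_n) :
  admissible U (fun x => (x == x0)%:R : R).
Proof.
by split; [exact: dirac_dist | rewrite kl_dirac lte_fin lnn0 ltry].
Qed.

Lemma kl_push_dirac_ge (x0 : 'I_n) :
  ((ln n%:R - ln k%:R)%:E
    <= kl (push (fun x => (x == x0)%:R : R) K) (push U K))%E.
Proof.
have := push_dist (dirac_dist x0) coordK_markov.
set p := push _ K => dp.
rewrite push_unif_coordK kl_unif // lee_fin.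
have Y0 : 0 < #|{: Y}|%:R :> R by rewrite ltr0n.
rewrite -[leLHS](mulKf (lt0r_neq0 Y0)) ler_pM2l ?invr_gt0 //.
have -> : #|{: Y}|%:R * (ln n%:R - ln k%:R)
    = \sum_y #|{: Y}|%:R * p y * (ln n%:R - ln k%:R).
  by rewrite -mulr_suml -mulr_sumr dp.2 mulr1.
apply: ler_sum => y _; rewrite /p card_push_coordK /xlnx.
(* [S] counts the coordinates of [y] equal to [x0]: if it is 0 both sides vanish, otherwise the
   density is at least [n / k]. *)
have [S SE] : exists S : nat, \sum_(j < k) n%:R * (y j == x0)%:R = n%:R * S%:R :> R.
  by exists (\sum_(j < k) (y j == x0))%N; rewrite -mulr_sumr natr_sum.
rewrite SE; case: S SE => [|S] _; first by rewrite !mulr0 !mul0r.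
rewrite ler_wpM2l ?mulr_ge0 ?invr_ge0 ?ler0n // -ln_div ?posrE //.
have nk0 : 0 < n%:R / k%:R :> R by rewrite divr_gt0.
have le_nk : n%:R / k%:R <= k%:R^-1 * (n%:R * S.+1%:R) :> R.
  by rewrite mulrC ler_pM2l ?invr_gt0 // ler_peMr ?ler0n // ler1n.
by rewrite ler_ln ?posrE // (lt_le_trans nk0 le_nk).
Qed.

(** * Bounds on the two coefficients *)

Lemma alpha_coord_ge : (((1 - k%:R^-1) / (4 * n%:R))%:E <= alpha_coord R k n)%E.
Proof.
by apply: contraction_coef_ge => nu [dnu _]; exact: kl_push_coordK_le.
Qed.

Lemma alpha_coord_le : (alpha_coord R k n <= (ln k%:R / ln n%:R)%:E)%E.
Proof.
apply: contraction_coef_le (dirac_admissible (Ordinal (ltnW hn))) _.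
apply: le_trans (kl_push_dirac_ge _).
rewrite kl_dirac -EFinM lee_fin mulrBl mul1r divfK // gt_eqF //.
Qed.

Lemma delta_coord_ge : ((1 - k%:R^-1)%:E <= delta_coord R k n)%E.
Proof.
apply: contraction_coef_ge => nu [dnu _].
by rewrite opprB addrCA subrr addr0; exact: kl_push_coordP_le.
Qed.

(** This serves finiteness: the ratio at a Dirac mass is nonnegative, hence so is the supremum. *)
Lemma delta_coord_le1 : (delta_coord R k n <= 1%:E)%E.
Proof.
apply: contraction_coef_le (dirac_admissible (Ordinal (ltnW hn))) _.
rewrite subrr mul0e kl_unif_ge0 //.
exact: push_dist (dirac_dist _) coordP_markov.
Qed.

End CoordKernel.

(** Since [fine] sends infinite values to 0, the finiteness clauses ensure that the asymptotic
    claims concern the genuine coefficients. *)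
Theorem proposition12 (R : realType) (k : nat) (hk : (1 <= k)%N) :
  [/\ (forall n : nat, (2 <= n)%N ->
         [/\ is_markov_kernel (@coordK R k n),
             (forall (y : {ffun 'I_k -> 'I_n}) (x : 'I_n),
                reverse_kernel (unif R 'I_n) (@coordK R k n) y x
                = k%:R^-1 * \sum_(j < k) (y j == x)%:R),
             alpha_coord R k n \is a fin_num,
             delta_coord R k n \is a fin_num
           & ((1 - k%:R^-1)%:E <= delta_coord R k n)%E]),
      (fun n : nat => fine (alpha_coord R k n) : R^o)
        =O_\oo (fun n : nat => (ln n%:R)^-1 : R^o)
    & (2 <= k)%N ->
      (fun n : nat =>
         fine (delta_coord R k n) / fine (alpha_coord R k n) : R^o)
        =Omega_\oo (fun n : nat => ln n%:R : R^o)].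
Proof.
have fin_alpha n : (2 <= n)%N -> alpha_coord R k n \is a fin_num.
  by move=> hn; exact: fin_num_between (alpha_coord_ge R hk hn) (alpha_coord_le R hk hn).
have fin_delta n : (2 <= n)%N -> delta_coord R k n \is a fin_num.
  by move=> hn; exact: fin_num_between (delta_coord_ge R hk hn) (delta_coord_le1 R hk hn).
have kV1 : k%:R^-1 <= 1 :> R by rewrite invf_le1 ?ler1n ?ltr0n.
have alpha_ge n : (2 <= n)%N -> (1 - k%:R^-1) / (4 * n%:R) <= fine (alpha_coord R k n).
  by move=> hn; rewrite -lee_fin fineK ?fin_alpha ?alpha_coord_ge.
have alpha_le n : (2 <= n)%N -> fine (alpha_coord R k n) <= ln k%:R / ln n%:R.
  by move=> hn; rewrite -lee_fin fineK ?fin_alpha ?alpha_coord_le.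
have delta_ge n : (2 <= n)%N -> 1 - k%:R^-1 <= fine (delta_coord R k n).
  by move=> hn; rewrite -lee_fin fineK ?fin_delta ?delta_coord_ge.
have lnn n : (2 <= n)%N -> 0 < ln (n%:R : R) by move=> hn; rewrite ln_gt0 ?ltr1n.
have lnk0 : 0 <= ln (k%:R : R) by rewrite ln_ge0 ?ler1n.
split.
- move=> n hn; split; [exact: coordK_markov|exact: reverse_coordK|exact: fin_alpha|
    exact: fin_delta|exact: delta_coord_ge].
(* The summand 1 keeps the constant positive when [k = 1], where [ln k] is 0. *)
- apply/eqO_exP; exists (ln k%:R + 1); first by rewrite ltr_wpDl.
  near=> n.
  have hn : (2 <= n)%N by near: n; exists 2%N.
  have a0 : 0 <= fine (alpha_coord R k n).
    apply: le_trans (alpha_ge n hn).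
    by rewrite divr_ge0 ?mulr_ge0 ?ler0n ?subr_ge0.
  rewrite ger0_norm // ger0_norm ?invr_ge0 ?(ltW (lnn n hn)) //.
  apply: le_trans (alpha_le n hn) _.
  by rewrite ler_wpM2r ?invr_ge0 ?(ltW (lnn n hn)) // lerDl ler01.
- move=> k2.
  have k1 : k%:R^-1 < 1 :> R by rewrite invf_lt1 ?ltr1n ?ltr0n.
  have lnk : 0 < ln (k%:R : R) by rewrite ln_gt0 ?ltr1n.
  rewrite eqOmegaE qualifE; apply/asboolP.
  (* The lower bound on delta divided by the upper bound on alpha, without the factor [ln n]. *)
  exists ((1 - k%:R^-1) / ln k%:R); first by rewrite divr_gt0 ?subr_gt0.
  near=> n.
  have hn : (2 <= n)%N by near: n; exists 2%N.
  (* Division by 0 returns 0, so alpha must be strictly positive; this uses [k >= 2]. *)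
  have a0 : 0 < fine (alpha_coord R k n).
    apply: lt_le_trans (alpha_ge n hn).
    by rewrite divr_gt0 ?mulr_gt0 ?ltr0n ?subr_gt0 // ltnW.
  have d0 : 0 <= fine (delta_coord R k n).
    by apply: le_trans (delta_ge n hn); rewrite subr_ge0.
  rewrite [in leRHS]ger0_norm ?divr_ge0 ?(ltW a0) // ger0_norm ?(ltW (lnn n hn)) //.
  rewrite -mulrA ler_pM ?mulr_ge0 ?invr_ge0 ?subr_ge0 ?(ltW (lnn n hn)) ?delta_ge //.
  rewrite -[X in _ * X]invrK -invfM lef_pV2 ?posrE ?divr_gt0 ?lnn //.
  exact: alpha_le.
Unshelve. all: by end_near. Qed.
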